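(* Let $G$ be a finitely generated group and let $S\subset G$ be a finite symmetric generating set of $G$. Then $C(G,S)=F(G,S)$ (as elements of $[0,\infty]$).
   Context: $|A|$ denotes the cardinality of a set $A$. For $x\in G$, $|x|_S=\min\{n\ge 0:\exists g_1,\dots,g_n\in S,\ x=g_1\cdots g_n\}$ (the empty product is the identity $e$). For real $r\ge 0$, $B_S(r)=\{x\in G:|x|_S\leq r\}$, and balls of negative radius are empty. $\Phi_S[v]=\inf\{r:|B_S(r)|>v\}$, with $\inf\emptyset=\infty$ and the convention $c/\infty=0$. For $\Omega\subset G$, $\partial_S\Omega=\{x\in\Omega:\exists s\in S,\ xs\in G\setminus\Omega\}$. In what follows $\Omega$ always ranges over finite non-empty subsets of $G$, and $\mathbb N=\{1,2,\dots\}$. The constant $C(G,S)$ is $$C(G,S)=\sup\left\{c\geq 0:\exists \alpha\geq 0\text{ such that }\forall\Omega\subset G,\ \frac{|\partial_S\Omega|}{|\Omega|}\geq c\,\frac{1}{\Phi_S[(1+\alpha)|\Omega|]}\right\}.$$ The Følner function of $G$ relative to $S$ is $\text{Føl}_S(n)=\min\left\{|\Omega|:\Omega\subset G,\ \frac{|\partial_S\Omega|}{|\Omega|}\leq\frac{1}{n}\right\}$ for $n\in\mathbb N$, equal to $\infty$ if no such $\Omega$ exists. The constant $F(G,S)$ is $$F(G,S)=\sup\left\{c\geq 0:\exists \alpha\geq 0,\ \exists \rho\geq 0\text{ such that }\forall n\in\mathbb N,\ \text{Føl}_S(n)\geq\frac{|B_S(cn-\rho)|}{1+\alpha}\right\}.$$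 *)

(* Defs.v *)
From mathcomp Require Import all_boot all_order all_algebra finmap.
From mathcomp Require Import all_classical all_reals ereal.

Set Implicit Arguments.
Unset Strict Implicit.
Unset Printing Implicit Defensive.

Import Order.TTheory GRing.Theory Num.Theory.

Local Open Scope classical_set_scope.
Local Open Scope ring_scope.
Local Open Scope ereal_scope.

Section WordMetric.
Context {R : realType} {G : groupType}.
Implicit Types (S Omega : {fset G}) (A : set G) (x : G).

Definition symmetric_set S : Prop := {in S, forall s, (s^-1)%g \in S}.

(* The only subgroup of G containing S is G itself. *)
Definition generating_set S : Prop :=
  forall H : {pred G}, group_closed H -> {subset S <= H} -> forall x, x \in H.

(* |x|_S. The infimum is over a set of natural numbers: it is a minimum as soon
   as x is a product of elements of S, and is +oo otherwise. *)
Definition word_length S x : \bar R :=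
  ereal_inf [set (size w)%:R%:E |
    w in [set w : seq G | {subset w <= S} /\ x = (\prod_(g <- w) g)%g]].

(* B_S(r), for an arbitrary real r; it is empty for r < 0. *)
Definition wball S (r : R) : set G := [set x | word_length S x <= r%:E].

(* Cardinality of a finite set; only used for balls, which are finite because S
   is ([fset_set] would send an infinite set to the empty one). *)
Definition cardset A : nat := #|` fset_set A|.

(* Phi_S[v]; ereal_inf of the empty set is +oo. *)
Definition Phi S (v : R) : \bar R :=
  ereal_inf [set r%:E | r in [set r : R | (v < (cardset (wball S r))%:R)%R]].

Definition boundary S Omega : {fset G} :=
  [fset x in Omega | has (fun s => (x * s)%g \notin Omega) S]%fset.

Definition boundary_ratio S Omega : R :=
  (#|` boundary S Omega|%:R / #|` Omega|%:R)%R.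

(* In \bar R, division by +oo yields 0, as in the convention c / oo = 0. *)
Definition C_const S : \bar R :=
  ereal_sup [set c%:E | c in [set c : R | (0 <= c)%R /\
    exists2 alpha : R, (0 <= alpha)%R &
      forall Omega : {fset G}, Omega != fset0 ->
        c%:E / Phi S ((1 + alpha) * #|` Omega|%:R)%R
          <= (boundary_ratio S Omega)%:E]].

(* The infimum is a minimum when some Omega qualifies, and +oo otherwise. *)
Definition Folner S (n : nat) : \bar R :=
  ereal_inf [set #|` Omega|%:R%:E |
    Omega in [set Omega : {fset G} |
      Omega != fset0 /\ (boundary_ratio S Omega <= n%:R^-1)%R]].

Definition F_const S : \bar R :=
  ereal_sup [set c%:E | c in [set c : R | (0 <= c)%R /\
    exists alpha rho : R, [/\ (0 <= alpha)%R, (0 <= rho)%R &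
      forall n : nat, (0 < n)%N ->
        ((cardset (wball S (c * n%:R - rho)))%:R / (1 + alpha))%R%:E
          <= Folner S n]]].

End WordMetric.

Arguments C_const R {G} S.
Arguments F_const R {G} S.

(* Main.v *)
Require Import Defs.
From mathcomp Require Import all_boot all_order all_algebra finmap.
From mathcomp Require Import all_classical all_reals ereal.
From mathcomp Require Import lra.

Set Implicit Arguments.
Unset Strict Implicit.
Unset Printing Implicit Defensive.

Import Order.TTheory GRing.Theory Num.Theory.

Local Open Scope classical_set_scope.
Local Open Scope ring_scope.

(** Once the infima [Phi] and [Folner] are unfolded, a positive [c] is
    admissible for [C_const], with the constant [alpha], when
      r * ratio(Omega) < c  implies  |B(r)| <= (1 + alpha) |Omega|
    for all [Omega] and all real [r] (lemma [div_Phi_leP]), and admissible for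
    [F_const], with the constants [alpha] and [rho], when
      ratio(Omega) <= 1/n  implies  |B(c n - rho)| <= (1 + alpha) |Omega|
    for all [Omega] and all n >= 1 (lemma [Folner_geP]). In this form the
    second condition is the first one sampled at the values 1/n of the ratio,
    so the two differ only by rounding, which changes the radius by a bounded
    amount and is paid for by lowering [c] arbitrarily little.

    If [c] satisfies the first condition, it satisfies the second with
    [rho = 1], because (c n - 1) * ratio(Omega) < c whenever
    ratio(Omega) <= 1/n ([C_admissible_F]).

    Conversely, let [c] satisfy the second condition, let 0 < c' < c and
    r * ratio(Omega) < c'. With n = floor (r / c') the ratio is below 1/n, while
    r < c' (n + 1), and c' (n + 1) <= c n - rho as soon as [n] reaches a
    threshold [N] depending only on [c], [c'] and [rho]; then
    |B(r)| <= (1 + alpha) |Omega|. The remaining radii are at most c' N, and since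
    |Omega| >= 1 they are absorbed by enlarging [alpha] by |B(c' N)|
    ([F_admissible_C]). Letting [c'] tend to [c] gives the inequality of the
    suprema. *)

Section Profiles.
Context {R : realType} {G : groupType}.
Implicit Types (S Omega : {fset G}) (c v t r x : R) (n : nat).

Lemma bounded_words_finite S n : exists A : {fset G},
  forall w : seq G, (size w <= n)%N -> {subset w <= S} ->
    (\prod_(g <- w) g)%g \in A.
Proof.
elim: n => [|n [A hA]].
  by exists [fset 1%g]%fset => -[|//] _ _; rewrite big_nil inE.
exists (1%g |` [fset (s * a)%g | s in S, a in A])%fset.
case=> [|s w] sz wS; first by rewrite big_nil !inE eqxx.
rewrite big_cons; apply/fset1UP; right; apply: in_imfset2.
  by apply: wS; rewrite inE eqxx.
by apply: hA => // g gw; apply: wS; rewrite inE gw orbT.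
Qed.

(** [cardset] is meaningful on balls because of this finiteness: it would
    count an infinite set as empty. *)
Lemma wball_finite S r : finite_set (wball S r).
Proof.
have [A hA] := bounded_words_finite S (Num.truncn (r + 1)).+1.
apply: (@sub_finite_set _ _ [set` A]) => [x /= xr|]; last exact: finite_fset.
have: (word_length S x < (r + 1)%:E)%E.
  by apply: (le_lt_trans xr); rewrite lte_fin; lra.
move=> /ereal_inf_lt[_ [w [wS ->] <-]]; rewrite lte_fin => wr.
apply: hA => //; rewrite -(ler_nat R); apply: ltW.
exact: (lt_trans wr (truncnS_gt _)).
Qed.

Lemma cardset_wball_le S r1 r2 :
  r1 <= r2 -> (cardset (wball S r1) <= cardset (wball S r2))%N.
Proof.
move=> r12; apply: fsubset_leq_card; rewrite -fset_set_sub; last 2 first.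
- exact: wball_finite.
- exact: wball_finite.
by move=> x /= /le_trans; apply; rewrite lee_fin.
Qed.

Lemma word_length_ge0 S (g : G) : (0 <= word_length S g :> \bar R)%E.
Proof. by apply: le_ereal_inf_tmp => _ [w _ <-]; rewrite lee_fin. Qed.

Lemma cardset_wball_lt0 S r : r < 0 -> cardset (wball S r) = 0%N.
Proof.
move=> r0; have -> : wball S r = set0; last by rewrite /cardset fset_set0.
apply/seteqP; split=> // x /= xr.
have := le_trans (word_length_ge0 S x) xr.
by rewrite lee_fin leNgt r0.
Qed.

Lemma Phi_ge0 S v : 0 <= v -> (0 <= Phi S v)%E.
Proof.
move=> v0; apply: le_ereal_inf_tmp => _ [r /= vr <-]; rewrite lee_fin leNgt.
by apply/negP => /(cardset_wball_lt0 S) r0; move: vr; rewrite r0 ltNge v0.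
Qed.

(** The quotient [c / Phi v] is governed by the conventions at [0] and [+oo];
    this form is free of division, and covers [t = 0] and [Phi = +oo] alike. *)
Lemma div_Phi_leP S c v t : 0 < c -> 0 <= v -> 0 <= t ->
  (c%:E / Phi S v <= t%:E)%E <->
  (forall r, r * t < c -> (cardset (wball S r))%:R <= v).
Proof.
move=> c0 v0 t0; have := Phi_ge0 S v0; split=> [ct r rt|small].
- rewrite leNgt; apply/negP => vr.
  have: (Phi S v <= r%:E)%E by apply: ereal_inf_lbound; exists r.
  move: H ct; case: (Phi S v) => [p||] //.
  rewrite inver !lee_fin; case: eqP => [->|/eqP pn0] p0.
    by rewrite gt0_muley ?lte_fin // leye_eq.
  have {pn0}p0 : 0 < p by rewrite lt_neqAle eq_sym pn0.
  rewrite lee_fin ler_pdivrMr // => ct pr.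
  have : p * t <= r * t by apply: ler_wpM2r.
  lra.
- case E : (Phi S v) H => [p||] // p0; last by rewrite invey mule0 lee_fin.
  rewrite lee_fin in p0.
  have cpt : c <= p * t.
    rewrite leNgt; apply/negP => ptc.
    (* a radius just above [p] still multiplies [t] to something below [c] *)
    have [q pq qt] : exists2 q, p < q & q * t <= c.
      case: (eqVneq t 0) => [->|tn0].
        by exists (p + 1); [lra|rewrite mulr0 ltW].
      have tp : 0 < t by rewrite lt_neqAle eq_sym tn0.
      by exists (c / t); [rewrite ltr_pdivlMr|rewrite divfK].
    have : (Phi S v < q%:E)%E by rewrite E lte_fin.
    move=> /ereal_inf_lt[_ [r /= vr <-]]; rewrite lte_fin => rq.
    have : r * t < c.
      case: (eqVneq t 0) => [->|tn0]; first by rewrite mulr0.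
      by apply: lt_le_trans qt; rewrite ltr_pM2r // lt_neqAle eq_sym tn0.
    by move=> /small; rewrite leNgt vr.
  have pp : 0 < p.
    rewrite lt_neqAle p0 andbT; apply/eqP => p00.
    by move: cpt; rewrite -p00; lra.
  by rewrite inver gt_eqF // lee_fin ler_pdivrMr // mulrC.
Qed.

Lemma Folner_geP S n x :
  (x%:E <= Folner S n)%E <->
  (forall Omega, Omega != fset0 -> boundary_ratio S Omega <= n%:R^-1 :> R ->
    x <= #|` Omega|%:R).
Proof.
split=> [xF Omega O0 On|h].
  rewrite -lee_fin; apply: (le_trans xF).
  by apply: ereal_inf_lbound; exists Omega.
by apply: le_ereal_inf_tmp => _ [Omega [O0 On] <-]; rewrite lee_fin; apply: h.
Qed.

Lemma boundary_ratio_ge0 S Omega : 0 <= boundary_ratio S Omega :> R.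
Proof. exact: divr_ge0. Qed.

(** The radius [c n - 1] rather than [c n] makes the inequality strict:
    [n * ratio <= 1] gives [(c n - 1) * ratio <= c - ratio], and the case
    [ratio = 0] is immediate. *)
Lemma C_admissible_F S c alpha : 0 < c -> 0 <= alpha ->
  (forall Omega, Omega != fset0 ->
    (c%:E / Phi S ((1 + alpha) * #|` Omega|%:R)%R
      <= (boundary_ratio S Omega)%:E)%E) ->
  forall n, (0 < n)%N ->
    (((cardset (wball S (c * n%:R - 1)))%:R / (1 + alpha))%:E
       <= Folner (R := R) S n)%E.
Proof.
move=> c0 a0 hC n n0; apply/Folner_geP => Omega O0 On.
rewrite ler_pdivrMr ?[_ * (1 + _)]mulrC; last lra.
have t0 := boundary_ratio_ge0 S Omega.
have v0 : 0 <= (1 + alpha) * #|` Omega|%:R by apply: mulr_ge0 => //; lra.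
apply: (proj1 (div_Phi_leP S c0 v0 t0) (hC _ O0)).
move: On; rewrite -[n%:R^-1]mul1r ler_pdivlMr ?ltr0n // => On.
move: t0; rewrite le_eqVlt => /predU1P[<-|t0]; first by rewrite mulr0.
by have := ler_wpM2l (ltW c0) On; lra.
Qed.

(** Every ratio below [c' / r] lies below a value [1/n] with [c n - rho >= r]
    when [r] is large, the gap [c - c'] beating both [rho] and the rounding of
    [r / c']; the bounded radii that remain cost only a larger constant. *)
Lemma F_admissible_C S c c' alpha rho :
  0 < c' -> c' < c -> 0 <= alpha -> 0 <= rho ->
  (forall n, (0 < n)%N ->
    (((cardset (wball S (c * n%:R - rho)))%:R / (1 + alpha))%:E
      <= Folner (R := R) S n)%E) ->
  exists2 beta : R, 0 <= beta &
    forall Omega, Omega != fset0 ->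
      (c'%:E / Phi S ((1 + beta) * #|` Omega|%:R)%R
        <= (boundary_ratio S Omega)%:E)%E.
Proof.
move=> c'0 c'c a0 rho0 hF.
(* from [N] on, [c' (n + 1) <= c n - rho] *)
pose N := (Num.truncn ((c' + rho) / (c - c'))).+1.
pose M : R := (cardset (wball S (c' * N%:R)))%:R.
have M0 : 0 <= M by exact: ler0n.
exists (alpha + M) => [|Omega O0]; first exact: addr_ge0.
have O1 : 1 <= #|` Omega|%:R :> R by rewrite ler1n cardfs_gt0.
have t0 := boundary_ratio_ge0 S Omega.
apply/div_Phi_leP => // [|r rt]; first by apply: mulr_ge0 => //; lra.
have Oge0 : 0 <= #|` Omega|%:R :> R by exact: ler0n.
have aO : 0 <= alpha * #|` Omega|%:R by exact: mulr_ge0.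
have [rN|Nr] := leP r (c' * N%:R).
  apply: (@le_trans _ _ M); first by rewrite ler_nat cardset_wball_le.
  by have := ler_wpM2l M0 O1; lra.
(* for a large radius [r], the ratio is compared with the sample value 1/n *)
pose n := Num.truncn (r / c').
have r0 : 0 <= r / c'.
  by rewrite divr_ge0 ?(ltW c'0) // (le_trans _ (ltW Nr)) // mulr_ge0 // ltW.
have /andP[nr rn] := truncn_itv r0.
have Nn : (N <= n)%N by rewrite truncn_ge_nat // ler_pdivlMr // mulrC ltW.
have n0 : (0 < n)%N by exact: leq_trans Nn.
move: nr rn; rewrite -/n ler_pdivlMr // ltr_pdivrMr // => nr rn.
have On : boundary_ratio S Omega <= n%:R^-1 :> R.
  rewrite -[n%:R^-1]mul1r ler_pdivlMr ?ltr0n // -(ler_pM2r c'0) mul1r -mulrA.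
  by apply: le_trans (ltW rt); rewrite mulrC; apply: ler_wpM2r.
have rcn : r <= c * n%:R - rho.
  have : (c' + rho) / (c - c') <= n%:R.
    by apply: ltW; apply: lt_le_trans (truncnS_gt _) _; rewrite ler_nat.
  rewrite ler_pdivrMr ?subr_gt0 // => h.
  by move: rn; rewrite -natr1; lra.
have /Folner_geP/(_ Omega O0 On) := hF n n0.
rewrite ler_pdivrMr; last lra.
move=> h; have := cardset_wball_le S rcn; rewrite -(ler_nat R).
by have := mulr_ge0 M0 Oge0; lra.
Qed.

Lemma C_const_ge0 S : (0 <= C_const R S)%E.
Proof.
apply: ereal_sup_ubound; exists 0 => //; split=> //; exists 0 => // Omega _.
by rewrite mul0e lee_fin boundary_ratio_ge0.
Qed.

Lemma F_const_ge0 S : (0 <= F_const R S)%E.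
Proof.
(* the radius [-1] makes every ball empty *)
apply: ereal_sup_ubound; exists 0 => //; split=> //; exists 0, 1; split=> // n _.
rewrite mul0r cardset_wball_lt0 ?mul0r; last lra.
by apply/Folner_geP.
Qed.

End Profiles.

Theorem proposition3p8 (R : realType) (G : groupType) (S : {fset G})
    (S_sym : symmetric_set S) (S_gen : generating_set S) :
  C_const R S = F_const R S.
Proof.
apply/eqP; rewrite eq_le; apply/andP; split.
- apply: ge_ereal_sup => _ [c [c0 [alpha a0 hC]] <-].
  have [cle0|cgt0] := leP c 0.
    by apply: le_trans (F_const_ge0 S); rewrite lee_fin.
  apply: ereal_sup_ubound; exists c => //; split=> //.
  by exists alpha, 1; split=> //; exact: C_admissible_F hC.
- apply: ge_ereal_sup => _ [c [c0 [alpha [rho [a0 rho0 hF]]]] <-].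
  apply/lee_subgt0Pr => e e0; rewrite -EFinB.
  have [ce|ce] := leP (c - e) 0.
    by apply: le_trans (C_const_ge0 S); rewrite lee_fin.
  have cec : c - e < c by lra.
  apply: ereal_sup_ubound; exists (c - e) => //; split; first exact: ltW.
  exact: F_admissible_C ce cec a0 rho0 hF.
Qed.
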